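(* Let $d\ge1$ and $n\ge1$ be integers. For $f\in C(\overline{\Omega}_H)$ define $$\mathcal{I}_n^*f(\mathbf t):=\sum_{\mathbf j\in\mathbb{H}_n^*}f\big(\tfrac{\mathbf j}{(d+1)n}\big)\,\ell_{\mathbf j,n}(\mathbf t),$$ where $$\ell_{\mathbf j,n}(\mathbf t)=\Phi_n^*\big(\mathbf t-\tfrac{\mathbf j}{(d+1)n}\big),\qquad \Phi_n^*(\mathbf t)=\frac1{(d+1)n^d}\sum_{\mathbf k\in\mathbb{H}_n^*}c_{\mathbf k}^{(n)}\phi_{\mathbf k}(\mathbf t).$$ Then $\mathcal{I}_n^*f\in\mathcal{T}_n:=\mathrm{span}\{\phi_{\mathbf k}:\mathbf k\in\mathbb{H}_n^*\}$ and it satisfies $$\mathcal{I}_n^*f\big(\tfrac{\mathbf j}{(d+1)n}\big)=\begin{cases}f\big(\tfrac{\mathbf j}{(d+1)n}\big),&\mathbf j\in\mathbb{H}_n^\circ,\\[4pt] \displaystyle\sum_{\mathbf k\in\mathcal{S}_{\mathbf j}}f\big(\tfrac{\mathbf k}{(d+1)n}\big),&\mathbf j\in\mathbb{H}_n^*\setminus\mathbb{H}_n^\circ.\end{cases}$$ Furthermore, $\Phi_n^*(\mathbf t)$ is a real function and it satisfies $$\Phi_n^*(\mathbf t)=\frac1{(d+1)n^d}\sum_{j=1}^{d+1}\Bigg(\prod_{\substack{i=1\\ i\ne j}}^{d+1}\frac{\sin\pi nt_i}{\sin\pi t_i}\Bigg)\cos(\pi nt_j)\sum_{I\subseteq\{1,\dots,d+1\}\setminus\{j\}}\frac{|I|!\,(d-|I|)!}{(d+1)!}\cos\pi\Big(t_j+2\sum_{i\in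 I}t_i\Big).$$
   Context: Let $\mathbb{R}_H^{d+1}=\{\mathbf t\in\mathbb{R}^{d+1}:t_1+\cdots+t_{d+1}=0\}$, $\mathbb{Z}_H^{d+1}=\mathbb{Z}^{d+1}\cap\mathbb{R}_H^{d+1}$, and $\overline{\Omega}_H=\{\mathbf t\in\mathbb{R}_H^{d+1}:-1\le t_i-t_j\le 1,\ 1\le i<j\le d+1\}$. Functions $\phi_{\mathbf k}$, $\Phi_n^*$, $\ell_{\mathbf j,n}$ are functions of $\mathbf t\in\mathbb{R}_H^{d+1}$; quotients $\sin\pi n t/\sin\pi t$ are interpreted by continuous extension. Let $\mathbb{H}=\{\mathbf k\in\mathbb{Z}^{d+1}:k_1+\cdots+k_{d+1}=0,\ k_1\equiv k_2\equiv\cdots\equiv k_{d+1}\ (\mathrm{mod}\ d+1)\}$ and, for $\mathbf k\in\mathbb{H}$, $\phi_{\mathbf k}(\mathbf t)=e^{\frac{2\pi i}{d+1}\mathbf k\cdot\mathbf t}$. Define $$\mathbb{H}_n^*=\{\mathbf k\in\mathbb{H}:-n\le\tfrac{k_i-k_j}{d+1}\le n,\ 1\le i<j\le d+1\},\quad \mathbb{H}_n^\circ=\{\mathbf k\in\mathbb{H}:-n<\tfrac{k_i-k_j}{d+1}<n,\ 1\le i<j\le d+1\}.$$ For nonempty disjoint $I,J\subset\{1,\dots,d+1\}$ let $$B_{I,J}=\{\mathbf t\in\mathbb{R}_H^{d+1}:t_i>t_l>t_j=t_i-1\ \text{for all } i\in I,\ j\in J,\ l\notin I\cup J\}$$ (when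 $I\cup J=\{1,\dots,d+1\}$ the condition is just $t_j=t_i-1$ for all $i\in I$, $j\in J$). For $i,j\ge1$ with $i+j\le d+1$ let $\mathbb{H}_n^{i,j}$ be the set of $\mathbf k\in\mathbb{H}$ such that $\frac{\mathbf k}{(d+1)n}\in B_{I,J}$ for some disjoint $I,J$ with $|I|=i$, $|J|=j$; these sets are pairwise disjoint with union $\mathbb{H}_n^*\setminus\mathbb{H}_n^\circ$. The weights are $c_{\mathbf k}^{(n)}=1$ if $\mathbf k\in\mathbb{H}_n^\circ$ and $c_{\mathbf k}^{(n)}=1/\binom{i+j}{i}$ if $\mathbf k\in\mathbb{H}_n^{i,j}$. For $\mathbf j\in\mathbb{H}_n^*$ let $$\mathcal{S}_{\mathbf j}=\Big\{\mathbf k\in\mathbb{H}_n^*:\tfrac{\mathbf k}{(d+1)n}-\tfrac{\mathbf j}{(d+1)n}\in\mathbb{Z}_H^{d+1}\Big\}.$$ *)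

(* Defs.v *)
From HB Require Import structures.
From mathcomp Require Import all_boot all_order all_algebra.
From mathcomp Require Import complex.
From mathcomp Require Import all_classical all_reals all_analysis.

Set Implicit Arguments.
Unset Strict Implicit.
Unset Printing Implicit Defensive.

Import Order.TTheory GRing.Theory Num.Theory.
Import numFieldNormedType.Exports.

Local Open Scope classical_set_scope.
Local Open Scope ring_scope.
Local Open Scope complex_scope.

Definition Cexp (R : realType) (z : R[i]) : R[i] :=
  (expR (complex.Re z))%:C * (cos (complex.Im z) +i* sin (complex.Im z)).

Definition RH (R : realType) (d : nat) : set 'rV[R]_d.+1 :=
  [set t : 'rV[R]_d.+1 | \sum_i t 0 i = 0].

Definition ZH (R : realType) (d : nat) : set 'rV[R]_d.+1 :=
  [set t : 'rV[R]_d.+1 | RH t /\ forall i, t 0 i \is a Num.int].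

Definition OmegaH (R : realType) (d : nat) : set 'rV[R]_d.+1 :=
  [set t : 'rV[R]_d.+1 | RH t /\ forall i j : 'I_d.+1, (i < j)%N ->
             -1 <= t 0 i - t 0 j /\ t 0 i - t 0 j <= 1].
Arguments OmegaH R d _ : clear implicits.

Definition HH (d : nat) : set 'rV[int]_d.+1 :=
  [set k : 'rV[int]_d.+1 | \sum_i k 0 i = 0 /\
           forall i j, (k ord0 i = k ord0 j %[mod d.+1%:Z])%Z].

Definition Hstar (d n : nat) : set 'rV[int]_d.+1 :=
  [set k : 'rV[int]_d.+1 | HH k /\ forall i j : 'I_d.+1, (i < j)%N ->
     - n%:R <= (k 0 i - k 0 j)%:Q / d.+1%:R /\
     (k 0 i - k 0 j)%:Q / d.+1%:R <= n%:R].
Arguments Hstar d n _ : clear implicits.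

Definition Hcirc (d n : nat) : set 'rV[int]_d.+1 :=
  [set k : 'rV[int]_d.+1 | HH k /\ forall i j : 'I_d.+1, (i < j)%N ->
     - n%:R < (k 0 i - k 0 j)%:Q / d.+1%:R /\
     (k 0 i - k 0 j)%:Q / d.+1%:R < n%:R].
Arguments Hcirc d n _ : clear implicits.

Definition node (R : realType) (d n : nat) (k : 'rV[int]_d.+1) : 'rV[R]_d.+1 :=
  (d.+1%:R * n%:R)^-1 *: map_mx intr k.

Definition BIJ (R : realType) (d : nat) (I J : {set 'I_d.+1}) :
    set 'rV[R]_d.+1 :=
  [set t : 'rV[R]_d.+1 | RH t /\ forall i j, i \in I -> j \in J ->
     t 0 j = t 0 i - 1 /\
     forall l, l \notin I :|: J -> t 0 l < t 0 i /\ t 0 j < t 0 l].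

Definition Hbnd (R : realType) (d n i j : nat) : set 'rV[int]_d.+1 :=
  [set k : 'rV[int]_d.+1 | HH k /\ exists I J : {set 'I_d.+1},
     [/\ [disjoint I & J]%bool, #|I| = i, #|J| = j & BIJ I J (node R n k)]].
Arguments Hbnd R d n i j _ : clear implicits.

(* The pair (i, j) such that k lies in Hbnd R d n i j is unique, see
   weight_bnd; the weight is 0 outside Hstar. *)
Definition weight (R : realType) (d n : nat) (k : 'rV[int]_d.+1) : R :=
  if k \in Hcirc d n then 1
  else if [pick p : 'I_d.+2 * 'I_d.+2 |
            [&& (0 < p.1)%N, (0 < p.2)%N, (p.1 + p.2 <= d.+1)%N &
                k \in Hbnd R d n p.1 p.2]] is Some p
  then ('C(p.1 + p.2, p.1))%:R^-1
  else 0.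

Definition phi (R : realType) (d : nat) (k : 'rV[int]_d.+1)
    (t : 'rV[R]_d.+1) : R[i] :=
  Cexp (2 * pi%:C * 'i / d.+1%:R * (\sum_i (k 0 i)%:~R * t 0 i)%:C).

Definition Phistar (R : realType) (d n : nat) (t : 'rV[R]_d.+1) : R[i] :=
  (d.+1%:R * n%:R ^+ d)^-1 *
    \sum_(k \in Hstar d n) (weight R n k)%:C * phi k t.

Definition ell (R : realType) (d n : nat) (j : 'rV[int]_d.+1)
    (t : 'rV[R]_d.+1) : R[i] :=
  Phistar n (t - node R n j).

Definition Istar (R : realType) (d n : nat) (f : 'rV[R]_d.+1 -> R[i])
    (t : 'rV[R]_d.+1) : R[i] :=
  \sum_(j \in Hstar d n) f (node R n j) * ell n j t.

(* Trigonometric sums are functions on RH: values off RH are irrelevant. *)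
Definition Tn (R : realType) (d n : nat) : set ('rV[R]_d.+1 -> R[i]) :=
  [set g | exists a : 'rV[int]_d.+1 -> R[i],
     forall t, RH t -> g t = \sum_(k \in Hstar d n) a k * phi k t].
Arguments Tn R d n _ : clear implicits.

Definition Sset (R : realType) (d n : nat) (j : 'rV[int]_d.+1) :
    set 'rV[int]_d.+1 :=
  [set k : 'rV[int]_d.+1 | Hstar d n k /\ ZH (node R n k - node R n j)].
Arguments Sset R d n j _ : clear implicits.

Definition sine_quot (R : realType) (n : nat) (x : R) : R :=
  if sin (pi * x) == 0 then
    lim ((fun s : R => sin (pi * n%:R * s) / sin (pi * s)) @ x^')
  else sin (pi * n%:R * x) / sin (pi * x).

Lemma Hstar_le (d n : nat) (k : 'rV[int]_d.+1) : Hstar d n k ->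
  forall i j, k 0 i - k 0 j <= (n * d.+1)%:Z.
Proof.
move=> [_ h] i j.
have key (x : int) : x%:Q / d.+1%:R <= n%:R -> x <= (n * d.+1)%:Z.
  by rewrite ler_pdivrMr ?ltr0n// -natrM -(ler_int rat).
case: (ltngtP i j) => ij; first by apply: key; apply: (h i j ij).2.
- apply: key; have := (h j i ij).1.
  by rewrite lerNl -mulNr -rmorphN opprB.
- by rewrite (val_inj ij) subrr.
Qed.

(* Guarantees that the sums over Hstar are genuine finite sums. *)
Lemma finite_Hstar (d n : nat) : finite_set (Hstar d n).
Proof.
pose N := (n * d.+1)%N.
pose g (s : {ffun 'I_d.+1 -> 'I_(N + N).+1}) : 'rV[int]_d.+1 :=
  \row_i ((s i)%:Z - N%:Z).
apply: (@sub_finite_set _ _ (range g)); last exact/finite_image/finite_finset.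
move=> k hk; have [[k0 _] _] := hk.
have le i : k 0 i <= N%:Z /\ - N%:Z <= k 0 i.
  have /= su (x : int) : \sum_(j < d.+1) x = x * d.+1%:Z.
    by rewrite sumr_const card_ord -mulr_natr natz.
  have D0 : (0 : int) < d.+1%:Z by [].
  have e : k 0 i * d.+1%:Z = \sum_j (k 0 i - k 0 j) by rewrite sumrB k0 subr0 su.
  split; rewrite -(ler_pM2r D0) e -su; apply: ler_sum => j _.
    exact: Hstar_le.
  by rewrite lerNl opprB Hstar_le.
exists [ffun i => inord `|(k ord0 i + N%:Z)%R|%N] => //.
apply/rowP => i; rewrite !mxE ffunE; have [l1 l2] := le i.
have p : 0 <= k 0 i + N%:Z by rewrite -lerBlDr sub0r.
rewrite inordK ?gez0_abs ?addrK// ltnS -lez_nat gez0_abs// PoszD.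
by rewrite lerD2r.
Qed.

Lemma BIJ_argmax (R : realType) (d : nat) (I J : {set 'I_d.+1}) t :
  (0 < #|I|)%N -> (0 < #|J|)%N -> @BIJ R d I J t ->
  I = [set i | [forall l, t 0 l <= t 0 i]]%SET /\
  J = [set j | [forall l, t 0 j <= t 0 l]]%SET.
Proof.
move=> /card_gt0P[i0 i0I] /card_gt0P[j0 j0J] [_ h].
have eI i : i \in I -> t 0 i = t 0 i0.
  by move=> iI; have [+ _] := h i j0 iI j0J; have [-> _] := h i0 j0 i0I j0J;
     move/addIr.
have eJ j : j \in J -> t 0 j = t 0 i0 - 1 by move=> jJ; have [] := h i0 j i0I jJ.
have eL l : l \notin I -> l \notin J -> t 0 l < t 0 i0 /\ t 0 i0 - 1 < t 0 l.
  move=> lI lJ; rewrite -(eJ j0 j0J); apply: (h i0 j0 i0I j0J).2.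
  by rewrite finset.in_setU negb_or lI.
have lt1 : t 0 i0 - 1 < t 0 i0 by rewrite ltrBlDr ltrDl.
split; apply/finset.setP => x; rewrite finset.in_set; apply/idP/forallP.
- move=> /eI -> l; have [/eI->//|lI] := boolP (l \in I).
  have [/eJ->|lJ] := boolP (l \in J); first exact: ltW.
  by have [/ltW] := eL l lI lJ.
- move=> /(_ i0); apply: contraTT => xI; rewrite -ltNge.
  have [/eJ->//|xJ] := boolP (x \in J); by have [] := eL x xI xJ.
- move=> /eJ -> l; have [/eI->|lI] := boolP (l \in I); first exact: ltW.
  have [/eJ->//|lJ] := boolP (l \in J).
  by have [_ /ltW] := eL l lI lJ.
- move=> /(_ j0); rewrite (eJ j0)//; apply: contraTT => xJ; rewrite -ltNge.
  have [/eI->//|xI] := boolP (x \in I); by have [] := eL x xI xJ.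
Qed.

Lemma weight_circ (R : realType) (d n : nat) k :
  Hcirc d n k -> weight R n k = 1.
Proof. by move=> /mem_set hk; rewrite /weight hk. Qed.

Lemma weight_bnd (R : realType) (d n i j : nat) (k : 'rV[int]_d.+1) :
  (0 < n)%N -> (0 < i)%N -> (0 < j)%N -> (i + j <= d.+1)%N ->
  Hbnd R d n i j k -> weight R n k = ('C(i + j, i))%:R^-1.
Proof.
move=> n0 i0 j0 ij hk; rewrite /weight.
have nk : k \notin Hcirc d n.
  apply/negP => /set_mem[_ hc]; case: hk => _ [I [J [_ cI cJ [_ hB]]]].
  have /card_gt0P[a aI] : (0 < #|I|)%N by rewrite cI.
  have /card_gt0P[b bJ] : (0 < #|J|)%N by rewrite cJ.
  have [+ _] := hB a b aI bJ; rewrite !mxE => e.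
  have D0 : (d.+1%:R * n%:R : R) != 0 by rewrite -natrM pnatr_eq0 muln_eq0 -lt0n n0.
  have {}e : k 0 a - k 0 b = (d.+1 * n)%:Z.
    apply/eqP; rewrite -(eqr_int R) intrB -pmulrn natrM.
    by rewrite -(inj_eq (mulfI (invr_neq0 D0))) mulrBr e mulVf// subKr.
  have q : (d.+1 * n)%:Z%:Q / d.+1%:R = n%:R.
    by rewrite -pmulrn natrM mulrAC divff ?mul1r ?pnatr_eq0.
  case: (ltngtP a b) => ab.
  - by have [_] := hc a b ab; rewrite e q ltxx.
  - have [+ _] := hc b a ab; rewrite -[_ - _]opprB e rmorphN mulNr q.
    by rewrite ltxx.
  - have z : k 0 a - k 0 b = 0 by rewrite (val_inj ab) subrr.
    by move: e n0; rewrite z => -[] /esym/eqP; rewrite addn_eq0 => /andP[/eqP->].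
rewrite (negbTE nk); case: pickP => [[p1 p2]/= /and4P[p10 p20 _ /set_mem hp]|].
  case: hp hk => _ [I [J [_ cI cJ hB]]] [_ [I' [J' [_ cI' cJ' hB']]]].
  have [||EI EJ] := BIJ_argmax _ _ hB; rewrite ?cI ?cJ//.
  have [||EI' EJ'] := BIJ_argmax _ _ hB'; rewrite ?cI' ?cJ'//.
  by rewrite -cI -cJ -cI' -cJ' EI EJ EI' EJ'.
have iT : (i < d.+2)%N by rewrite ltnS (leq_trans _ ij)// leq_addr.
have jT : (j < d.+2)%N by rewrite ltnS (leq_trans _ ij)// leq_addl.
by move=> /(_ (Ordinal iT, Ordinal jT)); rewrite /= i0 j0 ij mem_set.
Qed.

(* Main.v *)
Require Import Defs.
From mathcomp Require Import all_boot all_order all_algebra.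
From mathcomp Require Import complex.
From mathcomp Require Import all_classical all_reals all_analysis.
From mathcomp Require Import ring lra zify.
From mathcomp Require Import fintype finset.
Import Order.TTheory GRing.Theory Num.Theory.
Import numFieldNormedType.Exports.

(** Write z_i = exp(2 pi i t_i), so that the product of the z_i is 1 on RH.
    Every frequency k of HH is (d+1) m - (sum m) (1, ..., 1) for an integer
    vector m that is unique up to adding a multiple of (1, ..., 1), and then
    phi_k(t) = z^m.  The condition k in Hstar says that the entries of m spread
    over at most n, so m can be taken in the cube {0, ..., n}^(d+1), either
    with smallest entry 0 or with largest entry n; each of the two choices is a
    bijection with Hstar.  If a entries of m are 0 and b entries are n, then the
    weight of k is 1 / C(a+b, a).

    The link with the product formula is the polynomial
      K(x) = sum_j (1 + x_j^n) prod_(i <> j) (1 + x_i + ... + x_i^(n-1))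
             * sum_(I not containing j) |I|! (d-|I|)! / (d+1)! * x^I,
    called [sym_kernel] below.  Expanded over the cube, the coefficient of x^m
    comes from the j with m_j = 0 and from those with m_j = n, and for each of
    them from an interval of sets I.  The numbers p! q! / (p+q+1)! are the
    beta integrals of x^p (1-x)^q, so their sum over an interval of sets is
    again such a number ([sum_beta_weight_interval]).  The coefficient is
    ([a > 0] + [b > 0]) / C(a+b, a), hence K(z) adds up the two parametrisations
    of the sum over Hstar, that is, it is twice this sum ([sum_Hstar_kernel]).

    The trigonometric sum is K(z) / 2 again: a sine quotient is a geometric sum
    times a power of exp(pi i t), these powers cancel against the cosine factors
    because the t_i add up to 0, and the two exponentials in each remaining
    cosine are exchanged by I -> complement of I and j ([trig_sum_kernel]).
    Reality of Phi follows.

    For the interpolation, let t be a difference of two nodes.  All z_i^n equal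
    the same number w.  If w <> 1, then (w - 1) K(z) contains the factor
    prod z_i - 1 = 0, by a telescoping sum ([sum_beta_weight_telescope]).
    If w = 1, then each geometric sum with z_i <> 1 vanishes, and since
    prod z_i = 1 no term of K(z) survives unless all z_i are 1.  So Phi is 1
    when t is an integer vector and 0 otherwise, which gives the sum over the
    congruence class; for an interior node this class has one element. *)

Set Implicit Arguments.
Unset Strict Implicit.
Unset Printing Implicit Defensive.
Local Open Scope ring_scope.

(** * Weights of subsets *)

(** The beta integral of x^p (1-x)^(d-p) over [0, 1]. *)
Definition beta_weight (F : numFieldType) (d p : nat) : F :=
  p`!%:R * (d - p)`!%:R / d.+1`!%:R.

(** Under the integral sign the sum is x^|U| (1-x)^(d-|W|), since each element
    of W outside U contributes a factor x + (1-x) = 1.  The proof removes these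
    elements one at a time. *)
Lemma sum_beta_weight_interval (F : numFieldType) (T : finType) (d : nat)
    (U W : {set T}) : U \subset W -> (#|W| <= d)%N ->
  \sum_(I : {set T} | (U \subset I) && (I \subset W)) beta_weight F d #|I| =
  (#|U|)`!%:R * (d - #|W|)`!%:R / (#|U| + (d - #|W|)).+1`!%:R.
Proof.
move: {2}(#|W :\: U|) (erefl #|W :\: U|) => r.
elim: r U W => [|r IH] U W eqr UW Wd.
  have {eqr}WU : W \subset U by rewrite -setD_eq0 -cards_eq0 eqr.
  have -> : W = U by apply/eqP; rewrite eqEsubset WU.
  rewrite (big_pred1 U) => [|I]; last by rewrite /= eqEsubset andbC.
  by rewrite /beta_weight subnKC // (leq_trans (subset_leq_card UW)).
have /card_gt0P[w] : (0 < #|W :\: U|)%N by rewrite eqr.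
rewrite inE => /andP[wU wW].
have cW : #|W| = #|W :\ w|.+1 by rewrite (cardsD1 w) wW.
rewrite (bigID (fun I : {set T} => w \in I)) /=.
have -> : \sum_(I : {set T} | (U \subset I) && (I \subset W) && (w \in I))
    beta_weight F d #|I| =
    \sum_(I : {set T} | (w |: U \subset I) && (I \subset W))
      beta_weight F d #|I|.
  by apply: eq_bigl => I; rewrite subUset sub1set andbC andbA.
have -> : \sum_(I : {set T} | (U \subset I) && (I \subset W) && (w \notin I))
    beta_weight F d #|I| =
    \sum_(I : {set T} | (U \subset I) && (I \subset W :\ w))
      beta_weight F d #|I|.
  by apply: eq_bigl => I; rewrite subsetD1 andbA.
have rE : #|W :\: (w |: U)| = r.
  have e : (W :\: U) :\ w = W :\: (w |: U).
    by apply/setP => x; rewrite !inE negb_or andbA.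
  by apply: succn_inj; rewrite -eqr (cardsD1 w (W :\: U)) inE wU wW e.
rewrite IH //; last by rewrite subUset sub1set wW.
rewrite IH.
- rewrite cardsU1 wU /= add1n cW.
  have -> : (d - #|W :\ w|)%N = (d - #|W :\ w|.+1).+1.
    by rewrite subnSK // -cW.
  move: #|U| (d - _)%N => u q; rewrite addnS addSn.
  rewrite !factS !natrM.
  have h m : (m`!%:R : F) != 0 by rewrite pnatr_eq0 -lt0n fact_gt0.
  have h' m : (m.+1%:R : F) != 0 by rewrite pnatr_eq0.
  move: (h (u + q)%N) (h' (u + q)%N) => huq h1.
  have -> : ((u + q).+2%:R : F) = u.+1%:R + q.+1%:R.
    by rewrite -natrD addnS addSn.
  by field; rewrite huq -natrD !nat1r -natrD !pnatr_eq0.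
- by rewrite setDDl.
- by rewrite subsetD1 UW.
- by rewrite -ltnS -cW ltnW // ltnS.
Qed.

(** * The symmetric kernel and its expansion over the cube *)

(** At x_i = exp(2 pi i t_i) with t in RH this is Phistar up to a constant, see
    [Phistar_kernel]; the expansion below holds for all x. *)
Definition sym_kernel (F : numFieldType) (d n : nat) (x : 'I_d.+1 -> F) : F :=
  \sum_j (1 + x j ^+ n) * (\prod_(i | i != j) \sum_(e < n) x i ^+ e) *
    \sum_(I : {set 'I_d.+1} | j \notin I) beta_weight F d #|I| *
      \prod_(i in I) x i.

Definition zeros (d n : nat) (m : {ffun 'I_d.+1 -> 'I_n.+1}) : {set 'I_d.+1} :=
  [set i | val (m i) == 0%N].
Definition tops (d n : nat) (m : {ffun 'I_d.+1 -> 'I_n.+1}) : {set 'I_d.+1} :=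
  [set i | val (m i) == n].

(** The exponents e for which x_i^e occurs in the factor of index i, when the
    term of [sym_kernel] indexed by j and I is written as a product over i. *)
Definition allowed (d n : nat) (j : 'I_d.+1) (I : {set 'I_d.+1}) (i : 'I_d.+1)
    (e : 'I_n.+1) : bool :=
  if i == j then (val e == 0%N) || (val e == n)
  else if i \in I then val e != 0%N else val e != n.

Lemma sum_allowed (F : numFieldType) (d n : nat) (j : 'I_d.+1)
    (I : {set 'I_d.+1}) (x : 'I_d.+1 -> F) (i : 'I_d.+1) :
  (0 < n)%N ->
  \sum_(e : 'I_n.+1 | allowed j I i e) x i ^+ e =
  if i == j then 1 + x i ^+ n
  else (if i \in I then x i else 1) * \sum_(e < n) x i ^+ e.
Proof.
move=> n0; rewrite /allowed; case: eqP => _.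
  rewrite (bigD1 ord0) //= (bigD1 ord_max) ?eqxx ?orbT -?val_eqE -?lt0n //=.
  rewrite big1 ?addr0 // => e; rewrite -!val_eqE /=.
  by case: eqP => //= _; case: eqP.
case: ifP => _.
  rewrite big_mkcond big_ord_recl /= add0r mulr_sumr.
  by apply: eq_bigr => e _; rewrite exprS.
rewrite big_mkcond big_ord_recr /= eqxx addr0 mul1r.
by apply: eq_bigr => e _; rewrite neq_ltn ltn_ord.
Qed.

Lemma expand_sym_kernel_term (F : numFieldType) (d n : nat) (j : 'I_d.+1)
    (I : {set 'I_d.+1}) (x : 'I_d.+1 -> F) :
  (0 < n)%N -> j \notin I ->
  (1 + x j ^+ n) * (\prod_(i | i != j) \sum_(e < n) x i ^+ e) *
    \prod_(i in I) x i =
  \sum_(m : {ffun 'I_d.+1 -> 'I_n.+1} | [forall i, allowed j I i (m i)])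
    \prod_i x i ^+ m i.
Proof.
move=> n0 jI.
rewrite [RHS](eq_bigl (fun m => m \in family (allowed (n := n) j I)));
  last first.
  by move=> m; apply/forallP/familyP.
rewrite -(bigA_distr_big_dep _ (fun i (e : 'I_n.+1) => x i ^+ e)).
rewrite [RHS](eq_bigr _ (fun i _ => sum_allowed j I x i n0)).
rewrite [RHS](bigD1 j) //= eqxx -mulrA; congr (_ * _).
rewrite [RHS](eq_bigr (fun i => (if i \in I then x i else 1) *
  \sum_(e < n) x i ^+ e)) => [|i /negPf->//].
rewrite big_split /= mulrC -big_mkcondr; congr (_ * _).
by apply: eq_bigl => i; case: eqP => [->|_]; rewrite ?(negPf jI).
Qed.

(** For a fixed exponent m, the sets I whose term contains x^m form an interval.
    When m_j = n, both ends of it must be stripped of j, because I avoids j. *)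
Lemma allowedP (d n : nat) (j : 'I_d.+1) (I : {set 'I_d.+1})
    (m : {ffun 'I_d.+1 -> 'I_n.+1}) : (0 < n)%N ->
  (j \notin I) && [forall i, allowed j I i (m i)] =
  (j \in zeros m) && ((tops m \subset I) && (I \subset ~: zeros m)) ||
  (j \in tops m) &&
    ((tops m :\ j \subset I) && (I \subset ~: zeros m :\ j)).
Proof.
move=> n0; apply/idP/idP.
  case/andP=> jI /forallP al; have := al j; rewrite /allowed eqxx => /orP jm.
  have tI : tops m :\ j \subset I.
    apply/subsetP => i; rewrite !inE => /andP[ij /eqP mi].
    by have := al i; rewrite /allowed (negPf ij) mi eqxx; case: ifP.
  have Iz : I \subset ~: zeros m :\ j.
    apply/subsetP => i iI; rewrite !inE.
    have ij : i != j by apply: contraNneq jI => <-.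
    by have := al i; rewrite /allowed (negPf ij) iI => ->.
  case: jm => jm; apply/orP; [left|right]; apply/and3P; split; rewrite ?inE //.
    apply/subsetP => i it; apply: (subsetP tI); rewrite in_setD1 it andbT.
    apply: contraTneq it => ->; rewrite inE (eqP jm).
    by rewrite eq_sym -lt0n.
  by apply: subset_trans Iz _; apply: subD1set.
case/orP => /and3P[jm tI Iz].
  have jI : j \notin I.
    by apply/negP => /(subsetP Iz); rewrite inE jm.
  rewrite jI /=; apply/forallP => i; rewrite /allowed.
  have [->|ij] := eqVneq; first by rewrite inE in jm; rewrite jm.
  case: ifP => [/(subsetP Iz)|iI]; first by rewrite !inE.
  by apply: contraFN iI => it; apply: (subsetP tI); rewrite inE.
have jI : j \notin I.
  by apply/negP => /(subsetP Iz); rewrite !inE eqxx.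
rewrite jI /=; apply/forallP => i; rewrite /allowed.
have [->|ij] := eqVneq; first by rewrite inE in jm; rewrite jm orbT.
case: ifP => [/(subsetP Iz)|iI]; first by rewrite !inE => /andP[].
by apply: contraFN iI => it; apply: (subsetP tI); rewrite !inE ij.
Qed.

(** The weight of the frequency with coordinates m, see [weight_freq]. *)
Definition cube_weight (F : numFieldType) (d n : nat)
    (m : {ffun 'I_d.+1 -> 'I_n.+1}) : F :=
  ('C(#|tops m| + #|zeros m|, #|tops m|))%:R^-1.

Lemma tops_zeros_disj (d n : nat) (m : {ffun 'I_d.+1 -> 'I_n.+1}) :
  (0 < n)%N -> tops m \subset ~: zeros m.
Proof.
move=> n0; apply/subsetP => i; rewrite !inE => /eqP ->.
by rewrite -lt0n.
Qed.

Lemma card_nonzeros (d n : nat) (m : {ffun 'I_d.+1 -> 'I_n.+1}) :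
  (#|~: zeros m| = d.+1 - #|zeros m|)%N.
Proof. by rewrite cardsCs setCK card_ord. Qed.

Lemma cube_weightE (F : numFieldType) (d n : nat)
    (m : {ffun 'I_d.+1 -> 'I_n.+1}) :
  cube_weight F m = (#|tops m|)`!%:R * (#|zeros m|)`!%:R /
     (#|tops m| + #|zeros m|)`!%:R.
Proof.
rewrite /cube_weight -[in RHS](@bin_fact (_ + _) #|tops m|) ?leq_addr // addKn.
have h k : (k`!%:R : F) != 0 by rewrite pnatr_eq0 -lt0n fact_gt0.
have hb : ('C(#|tops m| + #|zeros m|, #|tops m|)%:R : F) != 0.
  by rewrite pnatr_eq0 -lt0n bin_gt0 leq_addr.
by rewrite !natrM; field; rewrite !h hb.
Qed.

(** With a zeros and b tops, each of the a indices j contributes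
    b! (a-1)! / (a+b)!. *)
Lemma sum_beta_weight_zeros (F : numFieldType) (d n : nat)
    (m : {ffun 'I_d.+1 -> 'I_n.+1}) : (0 < n)%N ->
  \sum_(j in zeros m)
    \sum_(I : {set 'I_d.+1} | (tops m \subset I) && (I \subset ~: zeros m))
       beta_weight F d #|I| = (zeros m != set0)%:R * cube_weight F m.
Proof.
move=> n0; rewrite sumr_const cube_weightE.
have [->|/set0Pn[j jz]] := eqVneq; first by rewrite cards0 mulr0n mul0r.
have : (0 < #|zeros m|)%N by apply/card_gt0P; exists j.
case E: #|zeros m| => [//|a] _.
have aN : (a <= d)%N by have := max_card (mem (zeros m)); rewrite E card_ord.
rewrite sum_beta_weight_interval ?tops_zeros_disj // card_nonzeros E subSS.
  2: exact: leq_subr.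
rewrite subKn // addnS (factS a) natrM mul1r -mulr_natl; ring.
Qed.

(** With a zeros and b tops, each of the b indices j contributes
    (b-1)! a! / (a+b)!. *)
Lemma sum_beta_weight_tops (F : numFieldType) (d n : nat)
    (m : {ffun 'I_d.+1 -> 'I_n.+1}) : (0 < n)%N ->
  \sum_(j in tops m)
    \sum_(I : {set 'I_d.+1} | (tops m :\ j \subset I) &&
                              (I \subset ~: zeros m :\ j))
       beta_weight F d #|I| = (tops m != set0)%:R * cube_weight F m.
Proof.
move=> n0; rewrite cube_weightE.
have [->|/set0Pn[j jz]] := eqVneq; first by rewrite big_set0 mul0r.
have : (0 < #|tops m|)%N by apply/card_gt0P; exists j.
case E: #|tops m| => [//|b] _.
have tz := tops_zeros_disj m n0.
transitivity (\sum_(j in tops m)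
  (b`!%:R * (#|zeros m|)`!%:R / (b + #|zeros m|).+1`!%:R : F)).
  apply: eq_bigr => i it.
  have cz : #|~: zeros m| = #|~: zeros m :\ i|.+1.
    by rewrite [LHS](cardsD1 i) (subsetP tz).
  have ct : #|tops m :\ i| = b.
    by apply: succn_inj; rewrite -E (cardsD1 i (tops m)) it.
  have zd : (#|zeros m| <= d)%N.
    have := cardsC (zeros m); rewrite cz card_ord addnS => -[e].
    rewrite -[leqRHS]e.
    exact: leq_addr.
  rewrite sum_beta_weight_interval ?setSD // ?ct.
    have -> : (d - #|~: zeros m :\ i| = #|zeros m|)%N.
      by rewrite -subSS -cz card_nonzeros subKn // ltnW.
    by [].
  rewrite -ltnS -cz card_nonzeros; exact: leq_subr.
rewrite sumr_const E (factS b) natrM mul1r -mulr_natl addSn; ring.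
Qed.

Lemma sym_kernel_expansion (F : numFieldType) (d n : nat) (x : 'I_d.+1 -> F) :
  (0 < n)%N ->
  sym_kernel n x = \sum_(m : {ffun 'I_d.+1 -> 'I_n.+1})
    ((zeros m != set0)%:R + (tops m != set0)%:R) * cube_weight F m *
    \prod_i x i ^+ m i.
Proof.
move=> n0.
transitivity (\sum_j \sum_(I : {set 'I_d.+1} | j \notin I)
   \sum_(m : {ffun 'I_d.+1 -> 'I_n.+1} | [forall i, allowed j I i (m i)])
     beta_weight F d #|I| * \prod_i x i ^+ m i).
  apply: eq_bigr => j _; rewrite mulr_sumr; apply: eq_bigr => I jI.
  by rewrite -mulr_sumr -expand_sym_kernel_term //; ring.
transitivity (\sum_(m : {ffun 'I_d.+1 -> 'I_n.+1}) \sum_j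
   (\sum_(I : {set 'I_d.+1} | (j \notin I) && [forall i, allowed j I i (m i)])
     beta_weight F d #|I|) * \prod_i x i ^+ m i).
  rewrite [RHS]exchange_big; apply: eq_bigr => j _ /=.
  rewrite (exchange_big_dep predT) //=; apply: eq_bigr => m _.
  by rewrite mulr_suml.
apply: eq_bigr => m _; rewrite -mulr_suml; congr (_ * _).
rewrite mulrDl -sum_beta_weight_zeros // -sum_beta_weight_tops //.
rewrite [in RHS]big_mkcond [X in _ = _ + X]big_mkcond -big_split /=.
apply: eq_bigr => j _; rewrite (eq_bigl _ _ (fun I => allowedP j I m n0)).
have [jz|jz] := boolP (j \in zeros m).
  have /negPf jt : j \notin tops m.
    by apply: contraL jz => /(subsetP (tops_zeros_disj m n0)); rewrite inE.
  by rewrite jt addr0; apply: eq_bigl => I; rewrite /= orbF.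
have [jt|jt] := boolP (j \in tops m); first by rewrite add0r.
by rewrite addr0 big_pred0.
Qed.

(** * Values of the kernel at roots of unity *)

(** For 0 < k < d+1 both products are k! (d+1-k)! / (d+1)!; at each end only one
    of them survives. *)
Lemma beta_weight_step (F : numFieldType) (d k : nat) : (k <= d.+1)%N ->
  k%:R * beta_weight F d k.-1 - (d.+1 - k)%:R * beta_weight F d k =
  (k == d.+1)%:R - (k == 0%N)%:R.
Proof.
have h m : (m`!%:R : F) != 0 by rewrite pnatr_eq0 -lt0n fact_gt0.
case: k => [_|k kd].
  rewrite mul0r !sub0r subn0 /beta_weight subn0 mul1r mulrA -natrM -factS.
  by rewrite divff.
rewrite /beta_weight /= eqSS subr0 subSS.
have -> : k.+1%:R * (k`!%:R * (d - k)`!%:R / d.+1`!%:R) =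
   k.+1`!%:R * (d - k)`!%:R / d.+1`!%:R :> F by rewrite (factS k) natrM !mulrA.
case: eqVneq => [->|kd'].
  by rewrite subnn mul0r subr0 mulr1 divff.
have -> : (d - k = (d - k.+1).+1)%N by rewrite subnSK // ltn_neqAle kd'.
rewrite (factS (d - k.+1)) natrM; apply/eqP; rewrite subr_eq0; apply/eqP.
ring.
Qed.

(** The monomial x^K arises from x_j x^I with I = K minus j, once for each j in
    K, and from - x^K, once for each j outside K.  By [beta_weight_step] these
    contributions cancel unless K is empty or full. *)
Lemma sum_beta_weight_telescope (F : numFieldType) (d : nat)
    (x : 'I_d.+1 -> F) :
  \sum_j (x j - 1) *
    \sum_(I : {set 'I_d.+1} | j \notin I) beta_weight F d #|I| *
      \prod_(i in I) x i =
  \prod_i x i - 1.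
Proof.
have E1 : \sum_j x j *
    \sum_(I : {set 'I_d.+1} | j \notin I) beta_weight F d #|I| *
      \prod_(i in I) x i =
  \sum_(K : {set 'I_d.+1}) #|K|%:R * beta_weight F d #|K|.-1 *
    \prod_(i in K) x i.
  transitivity (\sum_j \sum_(K : {set 'I_d.+1} | j \in K)
      beta_weight F d #|K|.-1 * \prod_(i in K) x i).
    apply: eq_bigr => j _; rewrite mulr_sumr.
    rewrite (reindex_onto (fun K => K :\ j) (fun I => j |: I)) /=; last first.
      by move=> I jI; rewrite setU1K.
    apply: eq_big => [K|K].
      rewrite !inE eqxx /=; apply/eqP/idP => [<-|/setD1K//].
      by rewrite setU11.
    case/andP => _ /eqP jK; have {}jK : j \in K by rewrite -jK setU11.
    rewrite (cardsD1 j K) jK /= [in RHS](big_setD1 j) //=; ring.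
  rewrite (exchange_big_dep predT) //=; apply: eq_bigr => K _.
  by rewrite sumr_const -[LHS]mulr_natl mulrA.
have E2 : \sum_j
    \sum_(I : {set 'I_d.+1} | j \notin I) beta_weight F d #|I| *
      \prod_(i in I) x i =
  \sum_(K : {set 'I_d.+1}) (d.+1 - #|K|)%:R * beta_weight F d #|K| *
    \prod_(i in K) x i.
  rewrite (exchange_big_dep predT) //=; apply: eq_bigr => K _.
  have -> : (d.+1 - #|K|)%N = #|~: K| by rewrite [RHS]cardsCs setCK card_ord.
  rewrite -mulrA mulr_natl -sumr_const.
  by apply: eq_bigl => j; rewrite inE.
under [LHS]eq_bigr => j _ do rewrite mulrBl mul1r.
rewrite sumrB E1 E2 -sumrB.
transitivity (\sum_(K : {set 'I_d.+1}) ((#|K| == d.+1)%:R * \prod_(i in K) x i -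
    (K == set0)%:R * \prod_(i in K) x i)).
  apply: eq_bigr => K _; rewrite -!mulrBl beta_weight_step ?cards_eq0 //.
  by have := max_card (mem K); rewrite card_ord.
rewrite sumrB; congr (_ - _).
  rewrite (bigD1 setT) //= cardsT card_ord eqxx mul1r.
  rewrite [X in _ + X]big1 ?addr0; last first.
    move=> K KT; case: eqP => [cK|]; last by rewrite mul0r.
    by case/eqP: KT; apply/eqP; rewrite eqEcard subsetT cardsT card_ord cK /=.
  by apply: eq_bigl => i; rewrite inE.
rewrite (bigD1 set0) //= eqxx mul1r big_set0 big1 ?addr0 // => K K0.
by rewrite (negPf K0) mul0r.
Qed.

Lemma sym_kernel_ones (F : numFieldType) (d n : nat) (x : 'I_d.+1 -> F) :
  (forall i, x i = 1) -> sym_kernel n x = 2 * (d.+1%:R * n%:R ^+ d).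
Proof.
move=> x1; rewrite /sym_kernel.
transitivity (\sum_(j < d.+1) 2 * n%:R ^+ d : F); last first.
  by rewrite sumr_const card_ord -mulr_natl; ring.
apply: eq_bigr => j _; rewrite x1 expr1n -[1 + 1]/2.
have -> : \sum_(I : {set 'I_d.+1} | j \notin I)
    beta_weight F d #|I| * \prod_(i in I) x i = 1.
  transitivity (\sum_(I : {set 'I_d.+1} |
      (set0 \subset I) && (I \subset ~: [set j]))
    beta_weight F d #|I|).
    apply: eq_big => [I|I _]; first by rewrite sub0set subsetC sub1set inE.
    by rewrite big1 ?mulr1.
  have cj : #|~: [set j]| = d by rewrite cardsC1 card_ord.
  rewrite sum_beta_weight_interval ?sub0set ?cj // cards0 subnn add0n fact0.
  by rewrite !mul1r invr1.
rewrite mulr1; congr (_ * _).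
rewrite (eq_bigr (fun=> n%:R)) => [|i _]; last first.
  under eq_bigr do rewrite x1 expr1n.
  by rewrite sumr_const card_ord.
by rewrite prodr_const cardC1 card_ord.
Qed.

(** Put G_i = 1 + x_i + ... + x_i^(n-1), so that (x_i - 1) G_i = w - 1.  If
    w = 1, then G_i = 0 for at least two indices i, as the product of the x_i is
    1, and each term contains one of these G_i.  If w <> 1, multiplication by
    w - 1 completes each product of G_i over i <> j to the full product times
    x_j - 1, and the remaining sum telescopes to 0. *)
Lemma sym_kernel_vanish (F : numFieldType) (d n : nat) (x : 'I_d.+1 -> F)
    (w : F) (i0 : 'I_d.+1) :
  \prod_i x i = 1 -> (forall i, x i ^+ n = w) -> x i0 != 1 ->
  sym_kernel n x = 0.
Proof.
move=> px xw xi0; pose G i := \sum_(e < n) x i ^+ e.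
have GE i : (x i - 1) * G i = w - 1 by rewrite -subrX1 xw.
have [w1|w1] := eqVneq w 1.
  have G0 i : x i != 1 -> G i = 0.
    move=> xi; apply: (mulfI (_ : x i - 1 != 0)); first by rewrite subr_eq0.
    by rewrite GE w1 subrr mulr0.
  have [i1 i10 xi1] : exists2 i1, i1 != i0 & x i1 != 1.
    apply/exists_inP; apply: contraT; rewrite negb_exists_in => /forall_inP h.
    move: xi0; rewrite -px (bigD1 i0) //= big1 ?mulr1 ?eqxx // => i ii0.
    by apply/eqP; rewrite -[_ == _]negbK h.
  rewrite /sym_kernel big1 // => j _.
  suff -> : \prod_(i < d.+1 | i != j) G i = 0 by rewrite mulr0 mul0r.
  have [->|ji] := eqVneq j i0; first by rewrite (bigD1 i1) //= G0 ?mul0r.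
  by rewrite eq_sym in ji; rewrite (bigD1 i0 ji) /= (G0 _ xi0) mul0r.
apply: (mulfI (_ : w - 1 != 0)); first by rewrite subr_eq0.
rewrite mulr0 /sym_kernel mulr_sumr.
transitivity ((1 + w) * (\prod_i G i) * \sum_j (x j - 1) *
    \sum_(I : {set 'I_d.+1} | j \notin I) beta_weight F d #|I| *
      \prod_(i in I) x i).
  rewrite mulr_sumr; apply: eq_bigr => j _.
  rewrite -(GE j) xw [\prod_i G i](bigD1 j) //= /G; ring.
by rewrite sum_beta_weight_telescope px subrr mulr0.
Qed.

(** * Frequencies as points of the cube *)

Local Open Scope classical_set_scope.
Local Open Scope complex_scope.

(** The exponential exp(2 pi i x), normalised to have period 1. *)
Definition cis (R : realType) (x : R) : R[i] :=
  cos (2 * pi * x) +i* sin (2 * pi * x).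

Lemma cisD (R : realType) (x y : R) : cis (x + y) = cis x * cis y.
Proof.
rewrite /cis mulrDr cosD sinD; apply/eqP.
by rewrite eq_complex /= eqxx /= addrC.
Qed.

Lemma cis0 (R : realType) : cis 0 = 1 :> R[i].
Proof. by rewrite /cis mulr0 cos0 sin0. Qed.

Lemma cis_neq0 (R : realType) (x : R) : cis x != 0.
Proof.
have h : cis (- x) * cis x = 1 by rewrite -cisD addNr cis0.
by apply: contra_eq_neq h => ->; rewrite mulr0 eq_sym oner_eq0.
Qed.

Lemma cisN (R : realType) (x : R) : cis (- x) = (cis x)^-1.
Proof.
apply: (mulIf (cis_neq0 x)).
by rewrite -cisD addNr cis0 mulVf // cis_neq0.
Qed.

Lemma cisMn (R : realType) (x : R) (n : nat) : cis (x * n%:R) = cis x ^+ n.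
Proof.
elim: n => [|n IH]; first by rewrite mulr0 cis0 expr0.
by rewrite mulrSr mulrDr mulr1 cisD IH exprSr.
Qed.

Lemma cis_sum (R : realType) (I : Type) (r : seq I) (P : pred I) (F : I -> R) :
  cis (\sum_(i <- r | P i) F i) = \prod_(i <- r | P i) cis (F i).
Proof. exact: (big_morph _ (@cisD R) (cis0 R)). Qed.

Lemma cis1 (R : realType) : cis 1 = 1 :> R[i].
Proof. by rewrite /cis mulr1 mulr_natl cos2pi sin2pi. Qed.

Lemma cis_int (R : realType) (x : R) : x \is a Num.int -> cis x = 1.
Proof.
move=> /intrP[[m|m] ->].
  by rewrite -pmulrn -[_%:R]mul1r cisMn cis1 expr1n.
by rewrite NegzE mulrNz cisN -pmulrn -[_%:R]mul1r cisMn cis1 expr1n invr1.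
Qed.

(** For the fractional part r of x, 1 = cos (2 pi r) = 1 - 2 sin (pi r)^2, while
    the sine is positive on ]0, pi[. *)
Lemma cis_eq1 (R : realType) (x : R) : cis x = 1 -> x \is a Num.int.
Proof.
move=> x1; pose r := x - (Num.floor x)%:~R.
have r1 : cis r = 1.
  by rewrite /r cisD x1 mul1r cisN cis_int ?invr1 // intr_int.
have r0 : 0 <= r by rewrite subr_ge0 Num.Theory.floor_le.
have rlt1 : r < 1.
  by rewrite ltrBlDr addrC -[1]/(1%:~R) -intrD floorD1_gt.
have [|re] := ltrP 0 r; last first.
  have : r = 0 by apply/eqP; rewrite eq_le re r0.
  by move/eqP; rewrite subr_eq0 => /eqP ->; rewrite intr_int.
move=> rgt0; exfalso.
have s : 0 < sin (pi * r).
  apply: sin_gt0_pi; rewrite mulr_gt0 ?pi_gt0 //=.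
  by rewrite -[ltRHS]mulr1 ltr_pM2l ?pi_gt0.
have : cos (2 * pi * r) = 1 by move: r1; rewrite /cis => -[].
rewrite -mulrA mulr_natl cos_mulr2n cos2sin2 => h.
have : sin (pi * r) ^+ 2 = 0 by lra.
by apply/eqP; rewrite gt_eqF // exprn_gt0.
Qed.

Lemma phiE (R : realType) (d : nat) (k : 'rV[int]_d.+1) (t : 'rV[R]_d.+1) :
  phi k t = cis (d.+1%:R^-1 * \sum_i (k 0 i)%:~R * t 0 i).
Proof.
rewrite /phi; set s := \sum_i _.
have -> : 2 * pi%:C * 'i / d.+1%:R * s%:C = (2 * pi * (d.+1%:R^-1 * s)) *i.
  have -> : (d.+1%:R : R[i])^-1 = (d.+1%:R^-1 : R)%:C.
    by rewrite fmorphV rmorph_nat.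
  have -> : (2 : R[i]) = (2 : R)%:C by rewrite rmorph_nat.
  by apply/eqP; rewrite eq_complex /=; apply/andP; split; apply/eqP; ring.
by rewrite /Cexp /= expR0 mul1r.
Qed.

Lemma phiB (R : realType) (d : nat) (k : 'rV[int]_d.+1) (t s : 'rV[R]_d.+1) :
  phi k (t - s) = phi k t * phi k (- s).
Proof.
rewrite !phiE -cisD -mulrDr -big_split; congr (cis (_ * _)).
by apply: eq_bigr => i _; rewrite !mxE mulrDr.
Qed.

(** The orthogonal projection of m to the hyperplane of zero sum, times d+1. *)
Definition freq (d n : nat) (m : {ffun 'I_d.+1 -> 'I_n.+1}) : 'rV[int]_d.+1 :=
  \row_i (d.+1%:Z * (m i)%:Z - \sum_l (m l)%:Z).

(** The common shift of all the entries of the frequency has no effect, because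
    the t_i add up to 0. *)
Lemma phi_freq (R : realType) (d n : nat) (m : {ffun 'I_d.+1 -> 'I_n.+1})
    (t : 'rV[R]_d.+1) : RH t ->
  phi (freq m) t = \prod_i cis (t 0 i) ^+ m i.
Proof.
move=> t0; rewrite phiE.
transitivity (cis (\sum_i t 0 i * (m i)%:R)); last first.
  by rewrite cis_sum; apply: eq_bigr => i _; rewrite cisMn.
congr cis; apply: (mulfI (_ : d.+1%:R != 0)); first by rewrite pnatr_eq0.
rewrite mulrA divff ?pnatr_eq0 // mul1r mulr_sumr.
transitivity (\sum_i (d.+1%:R * (t 0 i * (m i)%:R) -
    (\sum_l (m l)%:Z)%:~R * t 0 i)).
  by apply: eq_bigr => i _; rewrite !mxE rmorphB rmorphM /= -!pmulrn; ring.
by rewrite sumrB -!mulr_sumr t0 mulr0 subr0.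
Qed.

Lemma freq_sub (d n : nat) (m : {ffun 'I_d.+1 -> 'I_n.+1}) i j :
  freq m 0 i - freq m 0 j = d.+1%:Z * ((m i)%:Z - (m j)%:Z).
Proof. by rewrite !mxE; ring. Qed.

Lemma HH_freq (d n : nat) (m : {ffun 'I_d.+1 -> 'I_n.+1}) : HH (freq m).
Proof.
split=> [|i j].
  under eq_bigr do rewrite mxE.
  rewrite sumrB -mulr_sumr sumr_const card_ord -mulr_natl natz; ring.
by apply/eqP; rewrite eqz_mod_dvd freq_sub dvdz_mulr.
Qed.

Lemma freq_ratio (d n : nat) (m : {ffun 'I_d.+1 -> 'I_n.+1}) i j :
  (freq m 0 i - freq m 0 j)%:~R / d.+1%:R = ((m i)%:Z - (m j)%:Z)%:~R :> rat.
Proof.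
by rewrite freq_sub rmorphM /= -pmulrn [X in X / _]mulrC mulfK //.
Qed.

Lemma Hstar_freq (d n : nat) (m : {ffun 'I_d.+1 -> 'I_n.+1}) :
  Hstar d n (freq m).
Proof.
split=> [|i j _]; first exact: HH_freq.
rewrite freq_ratio [n%:R]pmulrn -rmorphN /= !ler_int.
have := ltn_ord (m i); have := ltn_ord (m j); lia.
Qed.

Lemma Hcirc_freq (d n : nat) (m : {ffun 'I_d.+1 -> 'I_n.+1}) :
  (zeros m == set0) || (tops m == set0) -> Hcirc d n (freq m).
Proof.
move=> h; split=> [|i j _]; first exact: HH_freq.
rewrite freq_ratio [n%:R]pmulrn -rmorphN /= !ltr_int.
have := ltn_ord (m i); have := ltn_ord (m j).
case/orP: h => /eqP h.
  have mz l : (0 < m l)%N.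
    by rewrite lt0n; apply/negP => ml; have := in_set0 l; rewrite -h inE ml.
  have := mz i; have := mz j; lia.
have mz l : (m l < n)%N.
  rewrite ltn_neqAle -ltnS ltn_ord andbT; apply/negP => ml.
  by have := in_set0 l; rewrite -h inE ml.
have := mz i; have := mz j; lia.
Qed.

(** The coordinates i and l of the node differ by (m_i - m_l) / n, so the entries
    n of m give the set I and the entries 0 give the set J. *)
Lemma Hbnd_freq (R : realType) (d n : nat) (m : {ffun 'I_d.+1 -> 'I_n.+1}) :
  (0 < n)%N -> Hbnd R d n #|tops m| #|zeros m| (freq m).
Proof.
move=> n0; split; first exact: HH_freq.
exists (tops m), (zeros m); split=> //.
  by rewrite disjoints_subset tops_zeros_disj.
have n0R : (n%:R : R) != 0 by rewrite pnatr_eq0 -lt0n.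
have tE i j : node R n (freq m) 0 i - node R n (freq m) 0 j =
    n%:R^-1 * ((m i)%:Z - (m j)%:Z)%:~R.
  rewrite ![node _ _ _ _ _]mxE ![map_mx _ _ _ _]mxE -mulrBr -intrB.
  rewrite freq_sub intrM -pmulrn.
  by field; rewrite n0R nat1r pnatr_eq0.
split.
  rewrite /RH /=; under eq_bigr do rewrite 2!mxE.
  by rewrite -mulr_sumr -rmorph_sum /= (HH_freq m).1 mulr0.
move=> i j it jz; have {}it : val (m i) = n by move: it; rewrite inE => /eqP.
have {}jz : val (m j) = 0%N by move: jz; rewrite inE => /eqP.
split.
  have := tE i j; rewrite it jz subr0 -pmulrn mulVf // => <-; ring.
move=> l; rewrite !inE negb_or => /andP[lt lz].
rewrite -subr_gt0 -[_ < node R n _ 0 l]subr_gt0 !tE.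
have h : 0 < n%:R^-1 :> R by rewrite invr_gt0 ltr0n.
rewrite !pmulr_rgt0 // !ltr0z it jz.
have := ltn_ord (m l); move: lt lz => /=; lia.
Qed.

Lemma weight_freq (R : realType) (d n : nat) (m : {ffun 'I_d.+1 -> 'I_n.+1}) :
  (0 < n)%N -> weight R n (freq m) = cube_weight R m.
Proof.
move=> n0; have [h|] := boolP ((zeros m == set0) || (tops m == set0)).
  rewrite weight_circ; last exact: Hcirc_freq.
  case/orP: h => /eqP h; rewrite /cube_weight h cards0.
    by rewrite addn0 binn invr1.
  by rewrite bin0 invr1.
rewrite negb_or -!card_gt0 => /andP[z0 t0].
apply: weight_bnd => //; last exact: Hbnd_freq.
rewrite addnC -leq_subRL; last first.
  by have := max_card (mem (zeros m)); rewrite card_ord.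
rewrite -card_nonzeros; apply: subset_leq_card; exact: tops_zeros_disj.
Qed.

(** A frequency determines the differences of the m_i, and then m itself once
    the smallest entry is known to be 0. *)
Lemma freq_inj_zeros (d n : nat) (m m' : {ffun 'I_d.+1 -> 'I_n.+1}) :
  (zeros m != set0) -> (zeros m' != set0) -> freq m = freq m' -> m = m'.
Proof.
case/set0Pn => i0; rewrite inE => /eqP z0.
case/set0Pn => i1; rewrite inE => /eqP z1 e.
have D i j : (m i)%:Z - (m j)%:Z = (m' i)%:Z - (m' j)%:Z.
  have := freq_sub m i j; rewrite e freq_sub => /mulfI -> //.
apply/ffunP => i; apply: val_inj => /=.
(* At i1 the two formulas for m_i give m i1 = - m' i0, so both are 0. *)
move: (D i i0) (D i1 i0) z0 z1 => /=; lia.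
Qed.

(** The symmetry of the cube that becomes k -> -k on frequencies.  It carries
    the results on vectors with smallest entry 0 to those with largest entry n. *)
Definition flip (d n : nat) (m : {ffun 'I_d.+1 -> 'I_n.+1}) :
    {ffun 'I_d.+1 -> 'I_n.+1} := [ffun i => rev_ord (m i)].

Lemma flipK (d n : nat) : involutive (@flip d n).
Proof. by move=> m; apply/ffunP => i; rewrite !ffunE rev_ordK. Qed.

Lemma freq_flip (d n : nat) (m : {ffun 'I_d.+1 -> 'I_n.+1}) :
  freq (flip m) = - freq m.
Proof.
have E i : (flip m i)%:Z = n%:Z - (m i)%:Z.
  by rewrite ffunE /=; have := ltn_ord (m i); lia.
apply/rowP => i; rewrite !mxE E.
under eq_bigr do rewrite E.
rewrite sumrB sumr_const card_ord -mulr_natl natz; ring.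
Qed.

Lemma zeros_flip (d n : nat) (m : {ffun 'I_d.+1 -> 'I_n.+1}) :
  zeros (flip m) = tops m.
Proof.
apply/setP => i; rewrite !inE ffunE /=.
have := ltn_ord (m i); lia.
Qed.

Lemma freq_inj_tops (d n : nat) (m m' : {ffun 'I_d.+1 -> 'I_n.+1}) :
  (tops m != set0) -> (tops m' != set0) -> freq m = freq m' -> m = m'.
Proof.
rewrite -!zeros_flip => z z' e.
apply: (can_inj (@flipK d n)); apply: freq_inj_zeros => //.
by rewrite !freq_flip e.
Qed.

(** Subtract the smallest entry of k from all of them, and divide by d+1. *)
Lemma freq_surj_zeros (d n : nat) (k : 'rV[int]_d.+1) : Hstar d n k ->
  exists2 m : {ffun 'I_d.+1 -> 'I_n.+1}, (zeros m != set0) & freq m = k.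
Proof.
move=> hk; have [[k0 kmod] _] := hk.
have [i0 _ i0min] :=
  arg_minP (fun i => k 0 i) (erefl (xpredT (ord0 : 'I_d.+1))).
have dv i : {q : nat | k 0 i - k 0 i0 = (q * d.+1)%:Z & (q < n.+1)%N}.
  apply/cid2; have /dvdzP[q qE] : (d.+1%:Z %| (k 0 i - k 0 i0)%R)%Z.
    by rewrite -eqz_mod_dvd; apply/eqP.
  have := i0min i isT; have := Hstar_le hk i i0.
  rewrite -subr_ge0 qE => le ge; exists `|q|%N; nia.
pose m : {ffun 'I_d.+1 -> 'I_n.+1} := [ffun i => inord (s2val (dv i))].
have mE i : d.+1%:Z * (m i)%:Z = k 0 i - k 0 i0.
  by rewrite ffunE inordK ?(s2valP' (dv i)) // [RHS](s2valP (dv i)) PoszM mulrC.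
exists m.
  apply/set0Pn; exists i0; rewrite inE; have := mE i0.
  by rewrite subrr => /eqP; rewrite mulf_eq0.
have S : \sum_l (m l)%:Z = - k 0 i0.
  apply: (mulfI (_ : d.+1%:Z != 0)) => //.
  rewrite mulr_sumr (eq_bigr _ (fun i _ => mE i)) sumrB k0 sumr_const card_ord.
  by rewrite -mulr_natl natz; ring.
by apply/rowP => i; rewrite mxE S mE; ring.
Qed.

Lemma Hstar_opp (d n : nat) (k : 'rV[int]_d.+1) :
  Hstar d n k -> Hstar d n (- k).
Proof.
by case/freq_surj_zeros => m _ <-; rewrite -freq_flip; apply: Hstar_freq.
Qed.

Lemma freq_surj_tops (d n : nat) (k : 'rV[int]_d.+1) : Hstar d n k ->
  exists2 m : {ffun 'I_d.+1 -> 'I_n.+1}, (tops m != set0) & freq m = k.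
Proof.
move=> /Hstar_opp/freq_surj_zeros[m mz mE]; exists (flip m).
  by rewrite -zeros_flip flipK.
by rewrite freq_flip mE opprK.
Qed.

Lemma sum_Hstar_freq (V : zmodType) (d n : nat) (g : 'rV[int]_d.+1 -> V)
    (P : pred {ffun 'I_d.+1 -> 'I_n.+1}) :
  (forall m m', P m -> P m' -> freq m = freq m' -> m = m') ->
  (forall k, Hstar d n k -> exists2 m, P m & freq m = k) ->
  \sum_(k \in Hstar d n) g k = \sum_(m | P m) g (freq m).
Proof.
move=> inj surj; rewrite (@bigfs _ _ _ _ (index_enum _) P); last first.
- by move=> m _; rewrite mem_index_enum.
- exact: index_enum_uniq.
apply: reindex_fsbig; split.
- by move=> m _; apply: Hstar_freq.
- by move=> m m' /set_mem /= mP /set_mem /= mP'; apply: inj.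
- by move=> k /surj[m mP <-]; exists m.
Qed.

(** The factor 2 stands for the two ways to represent the frequencies: by
    vectors of the cube with an entry 0, and by vectors with an entry n. *)
Lemma sum_Hstar_kernel (R : realType) (d n : nat) (t : 'rV[R]_d.+1) :
  (0 < n)%N -> RH t ->
  2 * \sum_(k \in Hstar d n) (weight R n k)%:C * phi k t =
  sym_kernel n (fun i => cis (t 0 i)).
Proof.
move=> n0 t0; rewrite sym_kernel_expansion //.
have E (P : pred {ffun 'I_d.+1 -> 'I_n.+1}) :
    (forall m m', P m -> P m' -> freq m = freq m' -> m = m') ->
    (forall k, Hstar d n k -> exists2 m, P m & freq m = k) ->
  \sum_(k \in Hstar d n) (weight R n k)%:C * phi k t =
  \sum_m (P m)%:R * cube_weight R[i] m * \prod_i cis (t 0 i) ^+ m i.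
  move=> inj surj; rewrite (sum_Hstar_freq _ inj surj) big_mkcond /=.
  apply: eq_bigr => m _; case: (P m); last by rewrite !mul0r.
  by rewrite mul1r weight_freq // phi_freq // /cube_weight fmorphV rmorph_nat.
rewrite mulr_natl mulr2n.
rewrite {1}(E _ (@freq_inj_zeros d n) (@freq_surj_zeros d n)).
rewrite (E _ (@freq_inj_tops d n) (@freq_surj_tops d n)) -big_split /=.
by apply: eq_bigr => m _; rewrite !mulrDl.
Qed.

(** * The trigonometric form of the kernel *)

(** The Dirichlet kernel, in the form of a real trigonometric polynomial. *)
Definition dirichlet (R : realType) (n : nat) (x : R) : R :=
  \sum_(e < n) cos (pi * ((2 * e + 1)%:R - n%:R) * x).

(** The product formula for a sine and a cosine makes the sum telescope. *)
Lemma sin_dirichlet (R : realType) (n : nat) (x : R) :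
  sin (pi * x) * dirichlet n x = sin (pi * n%:R * x).
Proof.
pose u (e : nat) : R := sin (pi * ((2 * e)%:R - n%:R) * x) / 2.
transitivity (\sum_(0 <= e < n) (u e.+1 - u e)).
  rewrite big_mkord mulr_sumr; apply: eq_bigr => e _; rewrite /u.
  pose b : R := pi * ((2 * e + 1)%:R - n%:R) * x; rewrite -/b.
  have -> : pi * ((2 * e.+1)%:R - n%:R) * x = b + pi * x.
    by rewrite /b mulnS !natrD; ring.
  have -> : pi * ((2 * e)%:R - n%:R) * x = b - pi * x.
    by rewrite /b natrD !natrM; ring.
  by rewrite sinD sinB; field.
rewrite telescope_sumr // /u.
have -> : pi * ((2 * n)%:R - n%:R) * x = pi * n%:R * x.
  by rewrite natrM; ring.
have -> : pi * ((2 * 0)%:R - n%:R) * x = - (pi * n%:R * x) by ring.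
by rewrite sinN; field.
Qed.

Lemma dirichlet_continuous (R : realType) (n : nat) (x : R) :
  {for x, continuous (@dirichlet R n)}.
Proof.
rewrite /dirichlet; apply: continuous_big => [|e _ /=].
  exact: add_continuous.
move=> y.
apply: (@continuous_comp _ _ _ (fun y => pi * ((2 * e + 1)%:R - n%:R) * y) cos).
  exact: mulrl_continuous.
exact: continuous_cos.
Qed.

(** If sin (pi x) = 0, then |sin (pi s)| = |sin (pi (s - x))|. *)
Lemma near_sin_pi_neq0 (R : realType) (x : R) :
  sin (pi * x) = 0 -> \forall s \near x^', sin (pi * s) != 0.
Proof.
move=> sx; have cx : cos (pi * x) != 0.
  by rewrite -normr_eq0 (sin0cos1 sx) oner_eq0.
near=> s.
have sx0 : s - x != 0 by rewrite subr_eq0; near: s; exact: nbhs_dnbhs_neq.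
have s1 : `|s - x| < 1.
  rewrite distrC; near: s; by apply: nbhs_dnbhs; exact: nbhsx_ballx.
have -> : pi * s = pi * x + pi * (s - x) by ring.
rewrite sinD sx mul0r add0r mulf_neq0 // -normr_eq0.
have -> : `|sin (pi * (s - x))| = `|sin (pi * `|s - x|)|.
  by case: (ler0P (s - x)) => _ //; rewrite mulrN sinN normrN.
rewrite normr_eq0 gt_eqF // sin_gt0_pi // mulr_gt0 ?pi_gt0 ?normr_gt0 //=.
by rewrite -[ltRHS]mulr1 ltr_pM2l ?pi_gt0.
Unshelve. all: by end_near.
Qed.

(** The Dirichlet kernel is continuous and agrees with the quotient near each
    zero of the denominator, so it gives the limit there. *)
Lemma sine_quotE (R : realType) (n : nat) (x : R) :
  sine_quot n x = dirichlet n x.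
Proof.
have q s : sin (pi * s) != 0 ->
    sin (pi * n%:R * s) / sin (pi * s) = dirichlet n s.
  by move=> s0; rewrite -sin_dirichlet mulrC mulKf.
rewrite /sine_quot; case: eqP => [sx|/eqP]; last exact: q.
apply: cvg_lim; first exact: Rhausdorff.
have : dirichlet n @ x^' --> dirichlet n x.
  by apply/continuous_withinNx; exact: dirichlet_continuous.
apply: cvg_trans; apply: near_eq_cvg.
by near do apply/esym/q; exact: near_sin_pi_neq0.
Unshelve. all: by end_near.
Qed.

Lemma cos_cis (R : realType) (y : R) :
  (cos (pi * y))%:C = (cis (y / 2) + cis (- (y / 2))) / 2.
Proof.
rewrite /cis mulrN cosN sinN.
have -> : 2 * pi * (y / 2) = pi * y by field.
have -> : (2 : R[i]) = (2 : R)%:C by rewrite rmorph_nat.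
rewrite -fmorphV; apply/eqP; rewrite eq_complex /=.
by apply/andP; split; apply/eqP; field.
Qed.

(** The exponents of the geometric sum, shifted to be symmetric about 0. *)
Lemma dirichlet_geometric (R : realType) (n : nat) (x : R) :
  (dirichlet n x)%:C = cis (- ((n%:R - 1) / 2 * x)) * \sum_(e < n) cis x ^+ e.
Proof.
pose c (e : nat) : R := ((2 * e + 1)%:R - n%:R) * x / 2.
have E : (dirichlet n x)%:C = \sum_(e < n) cis (c e).
  rewrite rmorph_sum /=.
  transitivity ((\sum_(e < n) cis (c e) + \sum_(e < n) cis (- c e)) / 2).
    rewrite -big_split mulr_suml; apply: eq_bigr => e _.
    by rewrite -mulrA cos_cis.
  suff -> : \sum_(e < n) cis (- c e) = \sum_(e < n) cis (c e) by field.
  rewrite (reindex_inj rev_ord_inj); apply: eq_bigr => e _ /=.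
  congr cis; rewrite /c.
  have -> : (n%:R : R) = (n - e.+1)%:R + e%:R + 1.
    by rewrite -addrA natr1 -natrD subnK.
  by rewrite !natrD; field.
rewrite E mulr_sumr; apply: eq_bigr => e _.
by rewrite -cisMn -cisD; congr cis; rewrite /c natrD natrM; field.
Qed.

Lemma beta_weight_real (R : realType) (d p : nat) :
  (beta_weight R d p)%:C = beta_weight R[i] d p.
Proof. by rewrite /beta_weight !rmorphM fmorphV /= !rmorph_nat. Qed.

(** Each cosine is half the sum of two conjugate exponentials.  The involution
    that sends I to the complement of I and j exchanges both families, because
    the t_i add up to 0 and the weights depend symmetrically on the sizes. *)
Lemma sum_beta_weight_cos (R : realType) (d : nat) (t : 'rV[R]_d.+1)
    (j : 'I_d.+1) :
  RH t ->
  cis (- (t 0 j / 2)) * (\sum_(I : {set 'I_d.+1} | j \notin I)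
     beta_weight R d #|I| * cos (pi * (t 0 j + 2 * \sum_(i in I) t 0 i)))%:C =
  \sum_(I : {set 'I_d.+1} | j \notin I)
     beta_weight R[i] d #|I| * \prod_(i in I) cis (t 0 i).
Proof.
move=> t0; set A := RHS.
pose s (I : {set 'I_d.+1}) : R := \sum_(i in I) t 0 i.
have AE : A = \sum_(I : {set 'I_d.+1} | j \notin I)
    beta_weight R[i] d #|I| * cis (s I).
  by apply: eq_bigr => I _; rewrite cis_sum.
pose c (I : {set 'I_d.+1}) := ~: (j |: I).
have cK (I : {set _}) : j \notin I -> c (c I) = I.
  move=> jI; apply/setP => i; rewrite !inE.
  by case: eqP => [->|_]; rewrite ?(negPf jI) /= ?negbK.
have cj (I : {set _}) : j \notin c I by rewrite !inE eqxx.
have sc (I : {set _}) : j \notin I -> s (c I) = - t 0 j - s I.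
  move=> jI; have := t0; rewrite /RH /= (bigID (mem (j |: I))) /= big_setU1 //=.
  move/eqP; rewrite addrC addr_eq0 => /eqP.
  rewrite opprD -/(s I) => <-.
  by apply: eq_bigl => i; rewrite inE.
have bc (I : {set _}) : j \notin I ->
    beta_weight R[i] d #|c I| = beta_weight R[i] d #|I|.
  move=> jI; have -> : #|c I| = (d - #|I|)%N.
    by rewrite cardsCs setCK card_ord cardsU1 jI /= add1n subSS.
  have Id : (#|I| <= d)%N.
    have := max_card (mem (j |: I)); rewrite cardsU1 jI card_ord add1n; exact.
  by rewrite /beta_weight subKn // [X in X / _]mulrC.
have AE' : A = \sum_(I : {set 'I_d.+1} | j \notin I)
    beta_weight R[i] d #|I| * cis (- t 0 j - s I).
  rewrite AE (reindex_onto c c) /=; last by move=> I; apply: cK.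
  apply: eq_big => [I|I /andP[_ /eqP e]].
    rewrite cj; apply/eqP/idP => [<-|]; [exact: cj | exact: cK].
  by have jI : j \notin I; rewrite ?bc ?sc // -e cj.
rewrite rmorph_sum mulr_sumr /=.
transitivity ((A + A) / 2); last by field.
rewrite {1}AE AE' -big_split mulr_suml; apply: eq_bigr => I jI /=.
rewrite rmorphM /= beta_weight_real cos_cis -/(s I) -mulrDr mulrCA -mulrA.
congr (_ * _).
by rewrite mulrA mulrDr -!cisD; congr ((cis _ + cis _) / _); field.
Qed.

(** By [dirichlet_geometric] each sine quotient is a geometric sum times
    cis (- (n-1)/2 t_i).  The product of these factors over i <> j is
    cis ((n-1)/2 t_j), the cosine of n pi t_j is cis (- n/2 t_j) (1 + x_j^n) / 2
    with x_j = cis t_j, and both together leave the factor cis (- t_j/2) of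
    [sum_beta_weight_cos]. *)
Lemma trig_sum_kernel (R : realType) (d n : nat) (t : 'rV[R]_d.+1) : RH t ->
  2 * (\sum_(j < d.+1)
      ((\prod_(i < d.+1 | i != j) sine_quot n (t 0 i)) *
        cos (pi * n%:R * t 0 j) *
        \sum_(I : {set 'I_d.+1} | j \notin I)
          ((#|I|)`!)%:R * ((d - #|I|)`!)%:R / (d.+1`!)%:R *
          cos (pi * (t 0 j + 2 * \sum_(i in I) t 0 i))))%:C =
  sym_kernel n (fun i => cis (t 0 i)).
Proof.
move=> t0; rewrite rmorph_sum mulr_sumr; apply: eq_bigr => j _.
rewrite -sum_beta_weight_cos // 2!rmorphM rmorph_prod /=.
rewrite (eq_bigr (fun i => cis (- ((n%:R - 1) / 2 * t 0 i)) *
    \sum_(e < n) cis (t 0 i) ^+ e)) => [|i _]; last first.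
  by rewrite sine_quotE dirichlet_geometric.
rewrite big_split /= -cis_sum.
have -> : \sum_(i < d.+1 | i != j) - ((n%:R - 1) / 2 * t 0 i) =
    (n%:R - 1) / 2 * t 0 j.
  rewrite sumrN -mulr_sumr; have := t0; rewrite /RH /= (bigD1 j) //=.
  by move/eqP; rewrite addrC addr_eq0 => /eqP ->; rewrite mulrN opprK.
rewrite -[pi * _ * _]mulrA cos_cis.
have E : 1 + cis (t 0 j) ^+ n =
    cis (n%:R * t 0 j / 2) *
    (cis (n%:R * t 0 j / 2) + cis (- (n%:R * t 0 j / 2))).
  by rewrite mulrDr -!cisD subrr cis0 addrC -cisMn; congr (cis _ + _); field.
have E' : cis ((n%:R - 1) / 2 * t 0 j) =
    cis (n%:R * t 0 j / 2) * cis (- (t 0 j / 2)).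
  by rewrite -cisD; congr cis; field.
by rewrite E E'; field.
Qed.

(** * Interpolation at the nodes *)

Lemma node_subE (R : realType) (d n : nat) (j k : 'rV[int]_d.+1) i :
  (node R n j - node R n k) 0 i = (j 0 i - k 0 i)%:~R / (d.+1%:R * n%:R).
Proof. by rewrite !mxE -mulrBr -intrB mulrC. Qed.

Lemma RH_node_sub (R : realType) (d n : nat) (j k : 'rV[int]_d.+1) :
  HH j -> HH k -> RH (node R n j - node R n k).
Proof.
move=> [j0 _] [k0 _]; rewrite /RH /=.
under eq_bigr do rewrite node_subE.
by rewrite -mulr_suml -rmorph_sum /= sumrB j0 k0 subrr mul0r.
Qed.

Lemma Phistar_kernel (R : realType) (d n : nat) (t : 'rV[R]_d.+1) :
  (0 < n)%N -> RH t ->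
  Phistar n t = (2 * (d.+1%:R * n%:R ^+ d))^-1 *
    sym_kernel n (fun i => cis (t 0 i)).
Proof.
move=> n0 t0; rewrite -sum_Hstar_kernel // /Phistar [(2 * _)^-1]invfM.
by rewrite mulrACA mulVf ?mul1r.
Qed.

(** The entries of an element of HH are congruent mod d+1, so the n-th powers of
    the exp (2 pi i t_i), for t the difference of the nodes, all coincide. *)
Lemma Phistar_node (R : realType) (d n : nat) (j k : 'rV[int]_d.+1) :
  (0 < n)%N -> HH j -> HH k ->
  Phistar n (node R n j - node R n k) =
  if k \in [set k | ZH (node R n k - node R n j)] then 1 else 0.
Proof.
move=> n0 hj hk; set t := _ - _.
have t0 : RH t := RH_node_sub R n hj hk.
have tN i : (node R n k - node R n j) 0 i = - t 0 i by rewrite !mxE opprB.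
rewrite Phistar_kernel //; case: ifPn => [/set_mem [_ tZ]|tZ].
  rewrite sym_kernel_ones ?mulVf // => [|i].
    by rewrite mulf_neq0 // mulf_neq0 ?expf_neq0 // pnatr_eq0 // -lt0n.
  by rewrite cis_int // -rpredN -tN.
have [i0 ti0] : exists i0, t 0 i0 \isn't a Num.int.
  apply/existsP; rewrite -negb_forall; apply: contra tZ => /forallP h.
  apply/mem_set; split; first exact: RH_node_sub.
  by move=> i; rewrite tN rpredN; apply: h.
rewrite (@sym_kernel_vanish _ _ _ _ (cis (t 0 i0) ^+ n) i0) ?mulr0 //.
- by rewrite -cis_sum t0 cis0.
- move=> i; rewrite -!cisMn.
  apply/(divIf (cis_neq0 (t 0 i0 * n%:R))); rewrite divff ?cis_neq0 //.
  rewrite -cisN -cisD.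
  apply: cis_int.
  have /eqP := hj.2 i i0; rewrite eqz_mod_dvd => /dvdzP[q qE].
  have /eqP := hk.2 i i0; rewrite eqz_mod_dvd => /dvdzP[r rE].
  have -> : t 0 i * n%:R - t 0 i0 * n%:R = (q - r)%:~R; last exact: intr_int.
  have nR : (n%:R : R) != 0 by rewrite pnatr_eq0 -lt0n.
  have dR : (d.+1%:R : R) != 0 by rewrite pnatr_eq0.
  apply: (mulIf dR); rewrite !node_subE -mulrBl -mulrBl -intrB.
  have -> : j 0 i - k 0 i - (j 0 i0 - k 0 i0) = (q - r) * d.+1%:Z.
    by rewrite mulrBl -qE -rE; ring.
  by rewrite [in LHS]intrM -pmulrn; field; rewrite nR nat1r dR.
- by apply: contra ti0 => /eqP/cis_eq1.
Qed.

Lemma Istar_node (R : realType) (d n : nat) (f : 'rV[R]_d.+1 -> R[i])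
    (j : 'rV[int]_d.+1) : (0 < n)%N -> HH j ->
  Istar n f (node R n j) = \sum_(k \in Sset R d n j) f (node R n k).
Proof.
move=> n0 hj.
have -> : Sset R d n j =
  Hstar d n `&` [set k | ZH (node R n k - node R n j)] by [].
rewrite fsbig_mkcondr; apply: eq_fsbigr => k /set_mem [hk _].
by rewrite /ell Phistar_node //; case: ifP; rewrite (mulr0, mulr1).
Qed.

Lemma Hcirc_lt (d n : nat) (k : 'rV[int]_d.+1) : (0 < n)%N -> Hcirc d n k ->
  forall i j, k 0 i - k 0 j < (n * d.+1)%:Z.
Proof.
move=> n0 [_ h] i j.
have key (x : int) : x%:Q / d.+1%:R < n%:R -> x < (n * d.+1)%:Z.
  by rewrite ltr_pdivrMr ?ltr0n // -natrM -(ltr_int rat).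
case: (ltngtP i j) => ij; first by apply: key; apply: (h i j ij).2.
- apply: key; have := (h j i ij).1.
  by rewrite ltrNl -mulNr -rmorphN opprB.
- by rewrite (val_inj ij) subrr ltz_nat muln_gt0 n0.
Qed.

(** An element of the class is k = j + (d+1) n z with z an integer vector of
    zero sum.  Entries of k differ by at most (d+1) n and those of j by less than
    that, so entries of z differ by at most 1; as they add up to 0, all are 0. *)
Lemma Sset_circ (R : realType) (d n : nat) (j : 'rV[int]_d.+1) :
  (0 < n)%N -> Hcirc d n j -> Sset R d n j = [set j].
Proof.
move=> n0 hj; apply/seteqP; split=> [k [hk [_ kZ]]|_ ->]; last first.
  split; last by rewrite subrr; split=> [|i]; rewrite /RH /= ?mxE ?rpred0 //;
    apply: big1 => i _; rewrite mxE.
  split; first exact: hj.1.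
  by move=> a b ab; have [? ?] := hj.2 a b ab; split; apply: ltW.
have nR : (n%:R : R) != 0 by rewrite pnatr_eq0 -lt0n.
have dR : (d.+1%:R : R) != 0 by rewrite pnatr_eq0.
have zP i : {z : int | k 0 i - j 0 i = z * (n * d.+1)%:Z}.
  apply/cid; have /intrP[z zE] := kZ i; exists z.
  apply/eqP; rewrite -(eqr_int R) intrM -zE node_subE -pmulrn natrM.
  by apply/eqP; field; rewrite nR nat1r dR.
pose z i := sval (zP i).
have zE i : k 0 i - j 0 i = z i * (n * d.+1)%:Z := svalP (zP i).
have N0 : 0 < (n * d.+1)%:Z by rewrite ltz_nat muln_gt0 n0.
have z2 a b : z a - z b <= 1.
  have := Hstar_le hk a b; have := Hcirc_lt n0 hj b a.
  have := zE a; have := zE b; move: N0.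
  move: (n * d.+1)%:Z (z a) (z b) (k 0 a) (k 0 b) (j 0 a) (j 0 b).
  move=> N za zb ka kb ja jb *; nia.
have zs : \sum_i z i = 0.
  apply: (mulIf (lt0r_neq0 N0)); rewrite mul0r mulr_suml.
  by rewrite -(eq_bigr _ (fun i _ => zE i)) sumrB hk.1.1 hj.1.1 subrr.
have zle a : z a <= 0.
  rewrite leNgt; apply/negP => za.
  have zb b : 0 <= z b by have := z2 a b; lia.
  have := @psumr_eq0P _ _ xpredT z (fun i _ => zb i) zs a isT; lia.
have z0 a : z a = 0.
  apply/eqP; rewrite -oppr_eq0; apply/eqP.
  apply: (@psumr_eq0P _ _ xpredT (fun i => - z i)) => //.
    by move=> i _; rewrite oppr_ge0.
  by rewrite sumrN zs oppr0.
apply/rowP => i; apply/eqP; rewrite -subr_eq0; apply/eqP.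
by have := zE i; rewrite z0 mul0r.
Qed.

Lemma Istar_in_Tn (R : realType) (d n : nat) (f : 'rV[R]_d.+1 -> R[i]) :
  Tn R d n (Istar n f).
Proof.
exists (fun k => \sum_(j \in Hstar d n) f (node R n j) *
  ((d.+1%:R * n%:R ^+ d)^-1 * ((weight R n k)%:C * phi k (- node R n j)))).
move=> t _; rewrite /Istar.
under eq_fsbigr do rewrite /ell /Phistar 2!mulr_fsumr.
rewrite exchange_fsbig; [|exact: finite_Hstar..].
apply: eq_fsbigr => k _; rewrite mulr_fsuml; apply: eq_fsbigr => j _.
by rewrite phiB; ring.
Qed.

Theorem theorem3p20 (R : realType) (d n : nat) (hd : (1 <= d)%N)
    (hn : (1 <= n)%N) :
  (forall f : 'rV[R]_d.+1 -> R[i]^o, {within OmegaH R d, continuous f} ->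
     Tn R d n (Istar n f) /\
     forall j : 'rV[int]_d.+1,
       (Hcirc d n j -> Istar n f (node R n j) = f (node R n j)) /\
       ((Hstar d n `\` Hcirc d n) j ->
          Istar n f (node R n j) =
            \sum_(k \in Sset R d n j) f (node R n k))) /\
  (forall t : 'rV[R]_d.+1, RH t ->
     Phistar n t \is Num.real /\
     Phistar n t =
       ((d.+1%:R * n%:R ^+ d)^-1 *
        \sum_(j < d.+1)
          ((\prod_(i < d.+1 | i != j) sine_quot n (t 0 i)) *
           cos (pi * n%:R * t 0 j) *
           \sum_(I : {set 'I_d.+1} | j \notin I)
             ((#|I|)`!)%:R * ((d - #|I|)`!)%:R / (d.+1`!)%:R *
             cos (pi * (t 0 j + 2 * \sum_(i in I) t 0 i))))%:C).
Proof.
split=> [f _|t t0].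
  split=> [|j]; first exact: Istar_in_Tn.
  split=> [hj|[hj _]]; last exact: (Istar_node f hn hj.1).
  by rewrite (Istar_node f hn hj.1) Sset_circ // fsbig_set1.
have cE : (d.+1%:R * n%:R ^+ d : R[i])^-1 = ((d.+1%:R * n%:R ^+ d)^-1 : R)%:C.
  by rewrite fmorphV rmorphM rmorphXn /= !rmorph_nat.
rewrite Phistar_kernel // -trig_sum_kernel // invfM mulrACA mulVf // mul1r.
rewrite cE -rmorphM; split; last by [].
by apply/complex_realP; eexists.
Qed.
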